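(* Let $\alpha\ge 0$ and let $\varphi$ be analytic with positive real part in $\mathbb{D}$, with $\varphi(0)=1$, $\varphi'(0)>0$, $\varphi(\mathbb{D})$ symmetric with respect to the real axis, and Taylor expansion $\varphi(z)=1+B_1z+B_2z^2+B_3z^3+\cdots$ (so $B_1>0$). If $f(z)=z+\sum_{n=2}^{\infty}a_nz^n$ belongs to the class $\mathcal{M}_{\sigma}(\alpha,\varphi)$, then $$|a_2|\le\frac{B_1\sqrt{B_1}}{\sqrt{(1+\alpha)\,|B_1^2+(1+\alpha)(B_1-B_2)|}}\qquad\text{and}\qquad |a_3|\le\frac{B_1+|B_2-B_1|}{1+\alpha}.$$
   Context: $\mathbb{D}=\{z\in\mathbb{C}:|z|<1\}$. $\mathcal{A}$ is the class of analytic functions $f$ on $\mathbb{D}$ with $f(0)=0$ and $f'(0)=1$. A function is univalent if it is analytic and injective. A function $f\in\mathcal{A}$ is bi-univalent if both $f$ and its inverse $f^{-1}$ are univalent in $\mathbb{D}$; that is, $f$ is univalent in $\mathbb{D}$ and the inverse of $f$, defined near $0$, extends to a univalent function on $\mathbb{D}$, still denoted $g=f^{-1}$. The class of bi-univalent functions is $\sigma$. An analytic function $F$ on $\mathbb{D}$ is subordinate to an analytic function $G$ on $\mathbb{D}$, written $F\prec G$, if there is an analytic $w:\mathbb{D}\to\mathbb{D}$ with $w(0)=0$ and $F(z)=G(w(z))$ for all $z\in\mathbb{D}$. A function $f\in\sigma$ is in $\mathcal{M}_{\sigma}(\alpha,\varphi)$ (bi-Mocanu-convex of Ma-Minda type)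 if $$(1-\alpha)\frac{zf'(z)}{f(z)}+\alpha\left(1+\frac{zf''(z)}{f'(z)}\right)\prec\varphi(z)\quad\text{and}\quad(1-\alpha)\frac{wg'(w)}{g(w)}+\alpha\left(1+\frac{wg''(w)}{g'(w)}\right)\prec\varphi(w),\qquad g=f^{-1}$$ (the quotients are taken with their removable singularity at $0$ filled in). Convention: a bound whose denominator vanishes is regarded as $+\infty$ (no assertion). *)

(* Defs.v *)
From Stdlib Require Import Reals.
From Coquelicot Require Import Coquelicot.

Local Open Scope C_scope.

Definition unit_disc (z : C) : Prop := Cmod z < 1.

(* [f z] is the sum of [a n * (z - z0) ^ n] for all [z] close to [z0]. *)
Definition has_power_series (f : C -> C) (z0 : C) (a : nat -> C) : Prop :=
  exists r : R, 0 < r /\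
    forall z : C, Cmod (z - z0) < r ->
      @is_pseries C_AbsRing C_NormedModule a (z - z0) (f z).

(* Functions on the disc are total functions [C -> C] whose values outside the
   disc are irrelevant: the disc is open, so analyticity at, and derivatives
   at, a point of the disc only depend on the values in the disc. *)
Definition analytic_on_disc (f : C -> C) : Prop :=
  forall z0 : C, unit_disc z0 -> exists a : nat -> C, has_power_series f z0 a.

Definition class_A (f : C -> C) : Prop :=
  analytic_on_disc f /\ f 0 = 0 /\ C_derive f 0 = 1.

Definition univalent (f : C -> C) : Prop :=
  analytic_on_disc f /\
  forall z1 z2 : C, unit_disc z1 -> unit_disc z2 -> f z1 = f z2 -> z1 = z2.

(* The inverse of [f], as a map from the image of the disc to the disc, is
   defined near 0 and agrees there with [g], which is univalent on the disc. *)
Definition univalent_inverse (f g : C -> C) : Prop :=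
  univalent g /\
  exists r : R, 0 < r /\
    forall w : C, Cmod w < r -> unit_disc (g w) /\ f (g w) = w.

Definition bi_univalent (f : C -> C) : Prop :=
  class_A f /\ univalent f /\ exists g : C -> C, univalent_inverse f g.

Definition subordinate (F G : C -> C) : Prop :=
  analytic_on_disc F /\ analytic_on_disc G /\
  exists w : C -> C,
    analytic_on_disc w /\
    (forall z : C, unit_disc z -> unit_disc (w z)) /\
    w 0 = 0 /\
    forall z : C, unit_disc z -> F z = G (w z).

(* [z f'(z) / f(z)]; since [f 0 = 0] and [f' 0 <> 0], its removable singularity
   at 0 is filled with the value 1. *)
Definition starlike_quotient (f : C -> C) (z : C) : C :=
  if Ceq_dec z 0 then 1 else z * C_derive f z / f z.

Definition mocanu (alpha : R) (f : C -> C) (z : C) : C :=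
  (1 - alpha) * starlike_quotient f z
  + alpha * (1 + z * C_derive (C_derive f) z / C_derive f z).

(* The analytic continuation [g] of the inverse of [f] to the disc is unique
   on the disc, so [exists g] only names it. *)
Definition M_sigma (alpha : R) (phi f : C -> C) : Prop :=
  bi_univalent f /\
  exists g : C -> C,
    univalent_inverse f g /\
    subordinate (mocanu alpha f) phi /\
    subordinate (mocanu alpha g) phi.

Definition ma_minda (phi : C -> C) : Prop :=
  analytic_on_disc phi /\
  (forall z : C, unit_disc z -> 0 < Re (phi z)) /\
  phi 0 = 1 /\
  (exists d : R, 0 < d /\ C_derive phi 0 = d) /\
  (forall z : C, unit_disc z ->
     exists z' : C, unit_disc z' /\ phi z' = Cconj (phi z)).

(* Main.v *)
Require Import Defs.
From Stdlib Require Import Reals Lra Lia ClassicalEpsilon List.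
From Coquelicot Require Import Coquelicot.

(** Write the two subordinations as [mocanu f = phi o u] and
    [mocanu g = phi o v] with Schwarz functions [u], [v], and let [a_n], [u_n],
    [v_n] be Taylor coefficients.  The inverse of [f] is
    [g = w - a_2 w^2 + (2 a_2^2 - a_3) w^3 + ...], so that comparing the
    coefficients of order one and two on both sides gives
      [(1 + alpha) a_2 = B_1 u_1],
      [2 (1 + 2 alpha) a_3 - (1 + 3 alpha) a_2^2 = B_1 u_2 + B_2 u_1^2],
      [- (1 + alpha) a_2 = B_1 v_1],
      [(3 + 5 alpha) a_2^2 - 2 (1 + 2 alpha) a_3 = B_1 v_2 + B_2 v_1^2].
    Hence [v_1 = - u_1].  With [s = u_2 + u_1^2] and [t = v_2 + v_1^2] the
    right-hand sides of order two are [B_1 s + (B_2 - B_1) u_1^2] and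
    [B_1 t + (B_2 - B_1) u_1^2].  Their sum eliminates [a_3] and yields
      [2 (1 + alpha) (B_1^2 + (1 + alpha) (B_1 - B_2)) a_2^2 = B_1^3 (s + t)],
    and adding [3 + 5 alpha] times one to [1 + 3 alpha] times the other
    eliminates [a_2] and leaves [4 (1 + alpha) (1 + 2 alpha) a_3].  Both bounds
    follow from [|u_1| <= 1], [|s| <= 1] and [|t| <= 1]
    ([coefficient_estimates]).

    The bounds on [u_1] and [s] are Caratheodory's inequalities [|c_n| <= 2] for
    [(1 + u) / (1 - u) = 1 + c_1 z + c_2 z^2 + ...], as [c_1 = 2 u_1] and
    [c_2 = 2 s].  For [c_2], averaging this half-plane-valued function over [z]
    and [-z] removes the term of order one and keeps [c_2]; returning to the
    disc gives [(u(z) + u(-z) - 2 u(z) u(-z)) / (2 - u(z) - u(-z))], which is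
    bounded by 1 and expands as [s z^2 + ...], so that the Schwarz lemma applies
    ([schwarz_coefficients]).

    Analyticity means local power series, so the Schwarz lemma has to be
    obtained without Cauchy's formula.  Every analytic function has third-order
    Taylor expansions [a + b h + c h^2 + d h^3 + O(h^4)], which are stable under
    sums, products, composition and inversion.  At an interior maximum of
    [Re f + eps |z|^2], the four points [z + i^k t] average the terms in [h],
    [h^2], [h^3] of [Re f] to zero while [eps |z|^2] gains [eps t^2], more than
    the error [O(t^4)]: this contradiction is the maximum principle
    ([Re_maximum_principle]).  The same expansions carry the comparison of
    coefficients; the derivatives in [mocanu f] enter it through termwise
    differentiation of power series ([expands_derive]). *)

Local Open Scope C_scope.

(** * Convergent power series at the origin *)

Definition sums_to (s : nat -> C) (l : C) : Prop :=
  @is_series C_AbsRing C_NormedModule s l.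

(** A power series centred at the origin, with the coefficient on the left;
    expansions at other points are reached by translating the function. *)
Definition expands (F : C -> C) (a : nat -> C) : Prop :=
  exists r : R, 0 < r /\
    forall h : C, Cmod h < r -> sums_to (fun n => a n * h ^ n) (F h).

Lemma pow_n_Cpow (z : C) (n : nat) : @pow_n C_Ring z n = z ^ n.
Proof. induction n as [|n IH]; [reflexivity|]. simpl. now rewrite <- IH. Qed.

Lemma expands_of_has_power_series (f : C -> C) (z0 : C) (a : nat -> C) :
  has_power_series f z0 a -> expands (fun h => f (z0 + h)) a.
Proof.
  intros [r [r0 H]]. exists r. split; [exact r0|]. intros h Hh.
  assert (E : z0 + h - z0 = h) by ring.
  specialize (H (z0 + h)). rewrite E in H. specialize (H Hh).
  refine (is_series_ext _ _ _ _ H). intros n.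
  change (@pow_n C_Ring h n * a n = a n * h ^ n).
  rewrite pow_n_Cpow. ring.
Qed.

Lemma has_power_series_at_0 (f : C -> C) (a : nat -> C) :
  has_power_series f 0 a -> expands f a.
Proof.
  intros H. destruct (expands_of_has_power_series _ _ _ H) as [r [r0 Hr]].
  exists r. split; [exact r0|]. intros h Hh. specialize (Hr h Hh).
  simpl in Hr. now rewrite Cplus_0_l in Hr.
Qed.

Lemma sums_to_unique (s : nat -> C) (l l' : C) :
  sums_to s l -> sums_to s l' -> l = l'.
Proof.
  exact (@filterlim_locally_unique nat C_AbsRing C_NormedModule eventually _
    (sum_n s) l l').
Qed.

Lemma Cmod_sum_n_le (s : nat -> C) (b : nat -> R) :
  (forall n, Cmod (s n) <= b n)%R ->
  forall n, (Cmod (@sum_n C_AbelianMonoid s n) <= sum_n b n)%R.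
Proof.
  intros H n. induction n as [|n IH].
  - rewrite !sum_O. apply H.
  - rewrite !sum_Sn.
    apply Rle_trans with (1 := Cmod_triangle _ _).
    now apply Rplus_le_compat.
Qed.

Lemma sums_to_Cmod_le (s : nat -> C) (l : C) (b : nat -> R) (L : R) :
  sums_to s l -> is_series b L -> (forall n, Cmod (s n) <= b n)%R ->
  (Cmod l <= L)%R.
Proof.
  intros Hs Hb H.
  refine (filterlim_le (F := eventually) (fun n => Cmod (sum_n s n)) (sum_n b)
    (Finite (Cmod l)) (Finite L) _ _ Hb).
  - exists 0%nat. intros n _. now apply Cmod_sum_n_le.
  - apply (filterlim_comp _ _ _ (sum_n s) Cmod _ _ _ Hs).
    exact (@filterlim_norm C_AbsRing C_NormedModule l).
Qed.

(** Each term is a difference of two partial sums, and these converge. *)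
Lemma sums_to_bounded (s : nat -> C) (l : C) :
  sums_to s l -> exists M : R, forall n, (Cmod (s n) <= M)%R.
Proof.
  intros Hs.
  destruct (@filterlim_bounded C_AbsRing C_NormedModule (sum_n s)
    (ex_intro _ l Hs)) as [M HM].
  assert (HM' : forall n, (Cmod (@sum_n C_AbelianMonoid s n) <= M)%R) by exact HM.
  exists (M + M)%R. intros [|n].
  - generalize (HM' 0%nat) (Cmod_ge_0 (s 0%nat)). rewrite sum_O. lra.
  - replace (s (S n)) with (@sum_n C_AbelianMonoid s (S n)
      + - @sum_n C_AbelianMonoid s n).
    + apply Rle_trans with (1 := Cmod_triangle _ _). rewrite Cmod_opp.
      now apply Rplus_le_compat.
    + rewrite sum_Sn. change (@plus C_AbelianMonoid) with Cplus. ring.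
Qed.

(** Convergence at one point [rho] of the positive axis bounds
    [|a n| rho ^ n]: this makes the series dominated by a geometric one on every
    smaller disc. *)
Lemma expands_bound (F : C -> C) (a : nat -> C) :
  expands F a ->
  exists rho M : R, (0 < rho)%R /\ (0 <= M)%R /\
    (forall n, Cmod (a n) * rho ^ n <= M)%R /\
    forall h, (Cmod h <= rho)%R -> sums_to (fun n => a n * h ^ n) (F h).
Proof.
  intros [r [r0 H]].
  assert (Hm : Cmod (RtoC (r / 2)) = (r / 2)%R).
  { rewrite Cmod_R, Rabs_pos_eq; lra. }
  assert (Hs := H (RtoC (r / 2))). rewrite Hm in Hs.
  destruct (sums_to_bounded _ _ (Hs ltac:(lra))) as [M HM].
  exists (r / 2)%R, M. repeat split.
  - lra.
  - exact (Rle_trans _ _ _ (Cmod_ge_0 _) (HM 0%nat)).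
  - intros n. generalize (HM n). now rewrite Cmod_mult, Cmod_pow, Hm.
  - intros h Hh. apply H. lra.
Qed.

Lemma is_series_geom_half (M : R) : is_series (fun n => M * (1/2) ^ n)%R (2 * M)%R.
Proof.
  replace (2 * M)%R with (scal M (/ (1 - 1/2)))%R.
  - apply (is_series_scal M (fun n => (1/2) ^ n)%R), is_series_geom.
    rewrite Rabs_pos_eq; lra.
  - change (M * (/ (1 - 1/2)) = 2 * M)%R. field.
Qed.

(** On the disc of radius [rho / 2] the series is dominated by
    [M (1/2) ^ n]. *)
Lemma expands_locally_bounded (F : C -> C) (a : nat -> C) :
  expands F a -> exists r K : R, (0 < r)%R /\ forall h, (Cmod h < r)%R -> (Cmod (F h) <= K)%R.
Proof.
  intros HF. destruct (expands_bound _ _ HF) as (rho & M & Hrho & HM & Hc & Hs).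
  exists (rho / 2)%R, (2 * M)%R. split; [lra|]. intros h Hh.
  refine (sums_to_Cmod_le _ _ _ _ (Hs h _) (is_series_geom_half M) _); [lra|].
  intros n. rewrite Cmod_mult, Cmod_pow.
  apply Rle_trans with (Cmod (a n) * (rho ^ n * (1/2) ^ n))%R.
  - rewrite <- Rpow_mult_distr. apply Rmult_le_compat_l; [apply Cmod_ge_0|].
    apply pow_incr. split; [apply Cmod_ge_0|lra].
  - rewrite <- Rmult_assoc. apply Rmult_le_compat_r; [|apply Hc].
    apply pow_le; lra.
Qed.

Lemma expands_at_0 (F : C -> C) (a : nat -> C) : expands F a -> F 0 = a 0%nat.
Proof.
  intros [r [r0 H]]. assert (H0 := H 0). rewrite Cmod_0 in H0. specialize (H0 r0).
  apply (sums_to_unique _ _ _ H0).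
  generalize (@is_pseries_0 C_AbsRing C_NormedModule a).
  apply is_series_ext. intros n.
  change (@pow_n C_Ring (RtoC 0) n * a n = a n * 0 ^ n). rewrite pow_n_Cpow. ring.
Qed.

(** The quotient [(F h - F 0) / h], with its removable singularity filled
    when [F] expands with coefficients [a]. *)
Definition slope (F : C -> C) (a : nat -> C) (h : C) : C :=
  if Ceq_dec h 0 then a 1%nat else (F h - a 0%nat) / h.

Lemma expands_slope (F : C -> C) (a : nat -> C) :
  expands F a ->
  expands (slope F a) (fun n => a (S n)).
Proof.
  intros [r [r0 H]]. exists r. split; [exact r0|]. intros h Hh.
  unfold slope. destruct (Ceq_dec h 0) as [->|h0].
  - generalize (@is_pseries_0 C_AbsRing C_NormedModule (fun n => a (S n))).
    apply is_series_ext. intros n.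
    change (@pow_n C_Ring (RtoC 0) n * a (S n) = a (S n) * 0 ^ n).
    rewrite pow_n_Cpow. ring.
  - specialize (H h Hh).
    replace ((F h - a 0%nat) / h) with (/ h * (F h - a 0%nat)) by (field; exact h0).
    assert (HS : sums_to (fun n => a (S n) * h ^ S n) (F h - a 0%nat)).
    { apply (is_series_incr_1 (fun n => a n * h ^ n)).
      change (sums_to (fun n => a n * h ^ n) (F h - a 0%nat + a 0%nat * 1)).
      replace (F h - a 0%nat + a 0%nat * 1) with (F h) by ring. exact H. }
    generalize (is_series_scal (/ h) _ _ HS). apply is_series_ext. intros n.
    change (/ h * (a (S n) * h ^ S n) = a (S n) * h ^ n).
    rewrite Cpow_S. field. exact h0.
Qed.

Lemma slope_spec (F : C -> C) (a : nat -> C) (h : C) :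
  expands F a -> F h = a 0%nat + h * slope F a h.
Proof.
  intros HF. unfold slope. destruct (Ceq_dec h 0) as [->|h0].
  - rewrite (expands_at_0 _ _ HF). ring.
  - field. exact h0.
Qed.

(** * Termwise differentiation *)

Lemma is_derive_of_quadratic_error (F : C -> C) (z l : C) (delta K : R) :
  (0 < delta)%R ->
  (forall h, (Cmod h < delta)%R ->
    (Cmod (F (z + h) - F z - h * l) <= K * Cmod h ^ 2)) ->
  @is_derive C_AbsRing C_NormedModule F z l.
Proof.
  intros Hd H. split.
  - exact (@is_linear_scal_l C_AbsRing C_NormedModule l).
  - intros x Hx. 
    rewrite <- (is_filter_lim_locally_unique _ _ Hx). clear x Hx. intros eps.
    assert (H1 : (0 < eps / (1 + Rabs K))%R).
    { apply Rdiv_lt_0_compat; [apply cond_pos|]. generalize (Rabs_pos K); lra. }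
    assert (H2 : (0 < Rmin delta (eps / (1 + Rabs K)))%R) by now apply Rmin_pos.
    exists (mkposreal _ H2). intros y Hy.
    change (Cmod (y - z) < Rmin delta (eps / (1 + Rabs K)))%R in Hy.
    change (Cmod (F y - F z - (y - z) * l) <= eps * Cmod (y - z)).
    assert (Hh := H (y - z)). assert (E : forall u : C, z + (u - z) = u) by (intros; ring).
    rewrite E in Hh.
    generalize (Rmin_l delta (eps / (1 + Rabs K))) (Rmin_r delta (eps / (1 + Rabs K))).
    intros Hl Hr. apply Rle_trans with (1 := Hh ltac:(lra)).
    simpl. rewrite Rmult_1_r, <- Rmult_assoc.
    apply Rmult_le_compat_r; [apply Cmod_ge_0|].
    apply Rle_trans with (Rabs K * (eps / (1 + Rabs K)))%R.
    + apply Rle_trans with (Rabs K * Cmod (y - z))%R.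
      * apply Rmult_le_compat_r; [apply Cmod_ge_0|apply Rle_abs].
      * apply Rmult_le_compat_l; [apply Rabs_pos|lra].
    + replace (Rabs K * (eps / (1 + Rabs K)))%R
        with (eps - eps / (1 + Rabs K))%R; [lra|].
      field. generalize (Rabs_pos K); lra.
Qed.

Lemma INR_le_pow2 (n : nat) : (INR n <= 2 ^ n).
Proof.
  induction n as [|n IH]; [simpl; lra|].
  rewrite S_INR. simpl. assert (1 <= 2 ^ n) by (apply pow_R1_Rle; lra). lra.
Qed.

(** The error [e n] of the first-order expansion of [z ^ n] satisfies
    [e (n+1) = (z + h) e n + n z ^ (n-1) h ^ 2]; the factor [2 ^ n] in the bound
    absorbs the second term, because [n <= 2 ^ n]. *)
Lemma pow_increment_error (s : R) (z h : C) (n : nat) :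
  (0 < s) -> (Cmod z <= s) -> (Cmod (z + h) <= s) ->
  (Cmod ((z + h) ^ n - z ^ n - RtoC (INR n) * z ^ pred n * h)
    <= (2 * s) ^ n * (Cmod h / s) ^ 2).
Proof.
  intros s0 Hz Hzh.
  assert (Hq : (0 <= (Cmod h / s) ^ 2)) by apply pow2_ge_0.
  induction n as [|n IH].
  - simpl. replace (1 - 1 - RtoC 0 * 1 * h) with (RtoC 0) by ring.
    rewrite Cmod_0. simpl in Hq. lra.
  - replace ((z + h) ^ S n - z ^ S n - RtoC (INR (S n)) * z ^ pred (S n) * h)
      with ((z + h) * ((z + h) ^ n - z ^ n - RtoC (INR n) * z ^ pred n * h)
            + RtoC (INR n) * z ^ pred n * h ^ 2).
    2:{ destruct n as [|n].
        - simpl. ring.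
        - rewrite (S_INR (S n)), RtoC_plus. simpl pred. rewrite !Cpow_S. ring. }
    apply Rle_trans with (1 := Cmod_triangle _ _).
    rewrite (Cmod_mult (z + h)).
    assert (H1 : (Cmod (z + h) * Cmod ((z + h) ^ n - z ^ n - RtoC (INR n) * z ^ pred n * h)
      <= s * ((2 * s) ^ n * (Cmod h / s) ^ 2))).
    { apply Rmult_le_compat; auto using Cmod_ge_0. }
    assert (H2 : (Cmod (RtoC (INR n) * z ^ pred n * h ^ 2)
      <= s * ((2 * s) ^ n * (Cmod h / s) ^ 2))).
    { rewrite !Cmod_mult, !Cmod_pow, Cmod_R, Rabs_pos_eq by apply pos_INR.
      replace (s * ((2 * s) ^ n * (Cmod h / s) ^ 2))%R
        with ((2 * s) ^ n / s * Cmod h ^ 2)%R by (field; lra).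
      apply Rmult_le_compat_r; [apply pow2_ge_0|].
      destruct n as [|n].
      - simpl. rewrite Rmult_0_l. apply Rlt_le, Rdiv_lt_0_compat; lra.
      - replace ((2 * s) ^ S n / s)%R with (2 ^ S n * s ^ n)%R.
        + apply Rmult_le_compat.
          * apply pos_INR.
          * apply pow_le, Cmod_ge_0.
          * apply INR_le_pow2.
          * apply pow_incr. split; [apply Cmod_ge_0|exact Hz].
        + rewrite Rpow_mult_distr. simpl. field. lra. }
    simpl pow in *. lra.
Qed.

(** Summing [pow_increment_error] against the coefficients shows that the
    series differs from its linearization by [O(h ^ 2)].  The radius [rho / 4]
    is chosen so that [(2 s) ^ n = (rho / 2) ^ n] still gives a geometric
    series. *)
Lemma expands_derive (F : C -> C) (a : nat -> C) :
  expands F a -> expands (C_derive F) (fun n => RtoC (INR (S n)) * a (S n)).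
Proof.
  intros HF. destruct (expands_bound _ _ HF) as (rho & M & Hrho & HM & Hc & Hs).
  set (s := (rho / 4)%R). assert (s0 : (0 < s)%R) by (unfold s; lra).
  assert (Hterm : forall n, (Cmod (a n) * (2 * s) ^ n <= M * (1/2) ^ n)).
  { intros n. replace (2 * s)%R with (rho * (1 / 2))%R by (unfold s; field).
    rewrite Rpow_mult_distr, <- Rmult_assoc.
    apply Rmult_le_compat_r; [apply pow_le; lra|apply Hc]. }
  exists s. split; [exact s0|]. intros z Hz.
  assert (Hex : exists g : C, sums_to (fun n => RtoC (INR n) * a n * z ^ pred n) g).
  { apply (@ex_series_le C_AbsRing C_CompleteNormedModule _
      (fun n => M / s * (1/2) ^ n)%R).
    - intros n.
      change (Cmod (RtoC (INR n) * a n * z ^ pred n) <= M / s * (1/2) ^ n).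
      rewrite !Cmod_mult, Cmod_pow, Cmod_R, Rabs_pos_eq by apply pos_INR.
      destruct n as [|n].
      + simpl. rewrite !Rmult_0_l, Rmult_1_r.
        apply Rmult_le_pos; [exact HM|apply Rlt_le, Rinv_0_lt_compat, s0].
      + apply Rle_trans with (2 ^ S n * Cmod (a (S n)) * s ^ n)%R.
        * apply Rmult_le_compat.
          -- apply Rmult_le_pos; [apply pos_INR|apply Cmod_ge_0].
          -- apply pow_le, Cmod_ge_0.
          -- apply Rmult_le_compat_r; [apply Cmod_ge_0|apply INR_le_pow2].
          -- apply pow_incr. split; [apply Cmod_ge_0|lra].
        * replace (2 ^ S n * Cmod (a (S n)) * s ^ n)%R
            with (Cmod (a (S n)) * (2 * s) ^ S n / s)%R.
          -- replace (M / s * (1 / 2) ^ S n)%R with (M * (1 / 2) ^ S n / s)%R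
               by (field; lra).
             apply Rmult_le_compat_r; [apply Rlt_le, Rinv_0_lt_compat, s0|apply Hterm].
          -- rewrite Rpow_mult_distr. simpl. field. lra.
    - exists (2 * (M / s))%R. apply is_series_geom_half. }
  destruct Hex as [g Hg].
  assert (HD : C_derive F z = g).
  { apply is_C_derive_unique.
    apply (is_derive_of_quadratic_error F z g (s - Cmod z) (2 * M / s ^ 2)); [lra|].
    intros h Hh.
    assert (Hzh : (Cmod (z + h) <= s)).
    { generalize (Cmod_triangle z h). lra. }
    assert (HA := Hs (z + h) ltac:(unfold s in *; lra)).
    assert (HB := Hs z ltac:(unfold s in *; lra)).
    assert (HE := is_series_minus _ _ _ _ (is_series_minus _ _ _ _ HA HB)
      (is_series_scal h _ _ Hg)).
    replace (2 * M / s ^ 2 * Cmod h ^ 2)%R with (2 * (M * (Cmod h / s) ^ 2))%R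
      by (field; lra).
    refine (sums_to_Cmod_le _ _ _ _ HE (is_series_geom_half _) _).
    intros n.
    change (Cmod (a n * (z + h) ^ n - a n * z ^ n
      - h * (RtoC (INR n) * a n * z ^ pred n))
      <= M * (Cmod h / s) ^ 2 * (1/2) ^ n).
    replace (a n * (z + h) ^ n - a n * z ^ n
      - h * (RtoC (INR n) * a n * z ^ pred n))
      with (a n * ((z + h) ^ n - z ^ n - RtoC (INR n) * z ^ pred n * h)) by ring.
    rewrite Cmod_mult.
    apply Rle_trans with (Cmod (a n) * ((2 * s) ^ n * (Cmod h / s) ^ 2))%R.
    - apply Rmult_le_compat_l; [apply Cmod_ge_0|].
      apply pow_increment_error; lra.
    - rewrite <- Rmult_assoc.
      replace (M * (Cmod h / s) ^ 2 * (1/2) ^ n)%R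
        with (M * (1/2) ^ n * (Cmod h / s) ^ 2)%R by ring.
      apply Rmult_le_compat_r; [apply pow2_ge_0|apply Hterm]. }
  rewrite HD.
  apply (is_series_incr_1 (fun n => RtoC (INR n) * a n * z ^ pred n)).
  change (sums_to (fun n => RtoC (INR n) * a n * z ^ pred n)
    (g + RtoC (INR 0) * a 0%nat * 1)).
  replace (g + RtoC (INR 0) * a 0%nat * 1) with g by (simpl; ring).
  exact Hg.
Qed.

(** * Third-order Taylor expansions *)

Definition near0 (P : C -> Prop) : Prop :=
  exists r : R, 0 < r /\ forall h : C, Cmod h < r -> P h.

Definition bigO (n : nat) (E : C -> C) : Prop :=
  exists K : R, near0 (fun h => Cmod (E h) <= K * Cmod h ^ n).

(** Order three is what the theorem needs: the identity that determines [a 3]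
    is compared up to [h ^ 3], and four-point averages see no monomial of
    degree one, two or three. *)
Definition taylor3 (F : C -> C) (a b c d : C) : Prop :=
  bigO 4 (fun h => F h - (a + b * h + c * h ^ 2 + d * h ^ 3)).

Lemma near0_and (P Q : C -> Prop) :
  near0 P -> near0 Q -> near0 (fun h => P h /\ Q h).
Proof.
  intros [r [r0 HP]] [s [s0 HQ]]. exists (Rmin r s).
  split; [now apply Rmin_pos|]. intros h Hh.
  generalize (Rmin_l r s) (Rmin_r r s). split; [apply HP|apply HQ]; lra.
Qed.

Lemma near0_imp (P Q : C -> Prop) :
  (forall h, P h -> Q h) -> near0 P -> near0 Q.
Proof. intros H [r [r0 HP]]. exists r. auto. Qed.

Lemma near0_at_0 (P : C -> Prop) : near0 P -> P 0.
Proof. intros [r [r0 H]]. apply H. now rewrite Cmod_0. Qed.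

Lemma near0_all (P : C -> Prop) : (forall h, P h) -> near0 P.
Proof. intros H. exists 1%R. split; [lra|auto]. Qed.

Lemma near0_small (r : R) : 0 < r -> near0 (fun h => Cmod h < r).
Proof. intros r0. exists r. auto. Qed.

Lemma bigO_ext (n : nat) (E G : C -> C) :
  near0 (fun h => E h = G h) -> bigO n E -> bigO n G.
Proof.
  intros H [K HK]. exists K.
  refine (near0_imp _ _ _ (near0_and _ _ H HK)). intros h [<- Hh]. exact Hh.
Qed.

Lemma bigO_ext_all (n : nat) (E G : C -> C) :
  (forall h, E h = G h) -> bigO n E -> bigO n G.
Proof. intros H. now apply bigO_ext, near0_all. Qed.

Lemma bigO_plus (n : nat) (E G : C -> C) :
  bigO n E -> bigO n G -> bigO n (fun h => E h + G h).
Proof.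
  intros [K HK] [L HL]. exists (K + L)%R.
  refine (near0_imp _ _ _ (near0_and _ _ HK HL)). intros h [H1 H2].
  generalize (Cmod_triangle (E h) (G h)). lra.
Qed.

Lemma bigO_mult (n m : nat) (E G : C -> C) :
  bigO n E -> bigO m G -> bigO (n + m) (fun h => E h * G h).
Proof.
  intros [K HK] [L HL]. exists (K * L)%R.
  refine (near0_imp _ _ _ (near0_and _ _ HK HL)). intros h [H1 H2].
  rewrite Cmod_mult, pow_add.
  replace (K * L * (Cmod h ^ n * Cmod h ^ m))%R
    with ((K * Cmod h ^ n) * (L * Cmod h ^ m))%R by ring.
  apply Rmult_le_compat; auto using Cmod_ge_0.
Qed.

Lemma bigO_weaken (n m : nat) (E : C -> C) : (m <= n)%nat -> bigO n E -> bigO m E.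
Proof.
  intros Hnm [K HK]. exists (Rabs K).
  refine (near0_imp _ _ _ (near0_and _ _ HK (near0_small 1 Rlt_0_1))).
  intros h [H1 H2]. apply Rle_trans with (1 := H1).
  apply Rle_trans with (Rabs K * Cmod h ^ n)%R.
  - apply Rmult_le_compat_r; [apply pow_le, Cmod_ge_0|apply Rle_abs].
  - apply Rmult_le_compat_l; [apply Rabs_pos|].
    replace n with (m + (n - m))%nat by lia. rewrite pow_add.
    rewrite <- (Rmult_1_r (Cmod h ^ m)) at 2.
    apply Rmult_le_compat_l; [apply pow_le, Cmod_ge_0|].
    rewrite <- (pow1 (n - m)). apply pow_incr. split; [apply Cmod_ge_0|lra].
Qed.

Lemma bigO_const (c : C) : bigO 0 (fun _ => c).
Proof. exists (Cmod c), 1%R. split; [lra|]. intros h _. simpl. lra. Qed.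

Lemma bigO_id : bigO 1 (fun h => h).
Proof. exists 1%R, 1%R. split; [lra|]. intros h _. simpl. lra. Qed.

Lemma bigO_pow (n : nat) : bigO n (fun h => h ^ n).
Proof. exists 1%R, 1%R. split; [lra|]. intros h _. rewrite Cmod_pow. lra. Qed.

Lemma bigO_near0 (E : C -> C) (P : C -> Prop) :
  bigO 1 E -> near0 P -> near0 (fun h => P (E h)).
Proof.
  intros [K HK] [r [r0 HP]].
  assert (H1 : 0 < r / (1 + Rabs K)).
  { apply Rdiv_lt_0_compat; [exact r0|]. generalize (Rabs_pos K); lra. }
  refine (near0_imp _ _ _ (near0_and _ _ HK (near0_small _ H1))).
  intros h [H2 H3]. apply HP. apply Rle_lt_trans with (1 := H2). simpl.
  rewrite Rmult_1_r. apply Rle_lt_trans with (Rabs K * (r / (1 + Rabs K)))%R.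
  - apply Rle_trans with (Rabs K * Cmod h)%R.
    + apply Rmult_le_compat_r; [apply Cmod_ge_0|apply Rle_abs].
    + apply Rmult_le_compat_l; [apply Rabs_pos|lra].
  - replace (Rabs K * (r / (1 + Rabs K)))%R with (r - r / (1 + Rabs K))%R; [lra|].
    field. generalize (Rabs_pos K); lra.
Qed.

Lemma bigO_comp (n : nat) (E G : C -> C) :
  bigO n E -> bigO 1 G -> bigO n (fun h => E (G h)).
Proof.
  intros [K HK] HG. assert (H := bigO_near0 _ _ HG HK). destruct HG as [L HL].
  exists (Rabs K * L ^ n)%R.
  refine (near0_imp _ _ _ (near0_and _ _ H HL)). intros h [H1 H2].
  apply Rle_trans with (1 := H1). simpl in H2. rewrite Rmult_1_r in H2.
  rewrite Rmult_assoc, <- Rpow_mult_distr.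
  apply Rle_trans with (Rabs K * Cmod (G h) ^ n)%R.
  - apply Rmult_le_compat_r; [apply pow_le, Cmod_ge_0|apply Rle_abs].
  - apply Rmult_le_compat_l; [apply Rabs_pos|].
    apply pow_incr. split; [apply Cmod_ge_0|exact H2].
Qed.

Lemma taylor3_ext (F G : C -> C) (a b c d : C) :
  near0 (fun h => F h = G h) -> taylor3 F a b c d -> taylor3 G a b c d.
Proof.
  intros H. apply bigO_ext. refine (near0_imp _ _ _ H). now intros h ->.
Qed.

Lemma taylor3_coef (F : C -> C) (a b c d a' b' c' d' : C) :
  taylor3 F a b c d -> a = a' -> b = b' -> c = c' -> d = d' -> taylor3 F a' b' c' d'.
Proof. intros; subst; assumption. Qed.

Lemma taylor3_poly (a b c d : C) :
  taylor3 (fun h => a + b * h + c * h ^ 2 + d * h ^ 3) a b c d.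
Proof.
  apply bigO_ext_all with (fun h => h ^ 4 * 0).
  - intros h. ring.
  - exact (bigO_mult 4 0 _ _ (bigO_pow 4) (bigO_const 0)).
Qed.

Lemma taylor3_const (c : C) : taylor3 (fun _ => c) c 0 0 0.
Proof.
  refine (taylor3_ext _ _ _ _ _ _ _ (taylor3_poly c 0 0 0)).
  apply near0_all. intros; ring.
Qed.

Lemma taylor3_id : taylor3 (fun h => h) 0 1 0 0.
Proof.
  refine (taylor3_ext _ _ _ _ _ _ _ (taylor3_poly 0 1 0 0)).
  apply near0_all. intros; ring.
Qed.

Lemma taylor3_plus (F G : C -> C) (a b c d a' b' c' d' : C) :
  taylor3 F a b c d -> taylor3 G a' b' c' d' ->
  taylor3 (fun h => F h + G h) (a + a') (b + b') (c + c') (d + d').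
Proof.
  intros HF HG. refine (bigO_ext_all _ _ _ _ (bigO_plus _ _ _ HF HG)).
  intros h. simpl. ring.
Qed.

Lemma bigO_poly (a b c d : C) : bigO 0 (fun h => a + b * h + c * h ^ 2 + d * h ^ 3).
Proof.
  assert (T : forall x n, bigO 0 (fun h => x * h ^ n)).
  { intros x n. apply (bigO_weaken (0 + n)); [lia|].
    exact (bigO_mult 0 n _ _ (bigO_const x) (bigO_pow n)). }
  repeat apply bigO_plus; auto using bigO_const.
  refine (bigO_ext_all _ _ _ _ (T b 1%nat)). intros h. ring.
Qed.

Lemma taylor3_bigO (F : C -> C) (a b c d : C) : taylor3 F a b c d -> bigO 0 F.
Proof.
  intros HF. apply (bigO_weaken _ 0) in HF; [|lia].
  refine (bigO_ext_all _ _ _ _ (bigO_plus _ _ _ HF (bigO_poly a b c d))).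
  intros h. simpl. ring.
Qed.

Lemma taylor3_bigO1 (F : C -> C) (b c d : C) : taylor3 F 0 b c d -> bigO 1 F.
Proof.
  intros HF. apply (bigO_weaken _ 1) in HF; [|lia].
  refine (bigO_ext_all _ _ _ _ (bigO_plus _ _ _ HF
    (bigO_mult 1 0 _ _ bigO_id (bigO_poly b c d 0)))).
  intros h. simpl. ring.
Qed.

Lemma taylor3_mult (F G : C -> C) (a b c d a' b' c' d' : C) :
  taylor3 F a b c d -> taylor3 G a' b' c' d' ->
  taylor3 (fun h => F h * G h) (a * a') (a * b' + b * a')
    (a * c' + b * b' + c * a') (a * d' + b * c' + c * b' + d * a').
Proof.
  intros HF HG.
  refine (bigO_ext_all _ _ _ _ (bigO_plus _ _ _ (bigO_plus _ _ _
    (bigO_mult 4 0 _ _ HF (taylor3_bigO _ _ _ _ _ HG))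
    (bigO_mult 4 0 _ _ HG (bigO_poly a b c d)))
    (bigO_mult 4 0 _ _ (bigO_pow 4)
       (bigO_poly (b * d' + c * c' + d * b') (c * d' + d * c') (d * d') 0)))).
  intros h. simpl. ring.
Qed.

Lemma taylor3_scal (F : C -> C) (x a b c d : C) :
  taylor3 F a b c d -> taylor3 (fun h => x * F h) (x * a) (x * b) (x * c) (x * d).
Proof.
  intros HF. apply (taylor3_coef _ _ _ _ _ _ _ _ _
    (taylor3_mult _ _ _ _ _ _ _ _ _ _ (taylor3_const x) HF)); ring.
Qed.

(** Expand the cubic polynomial of [F] in powers of [G]; the remainder of [F]
    is [O(G ^ 4)], hence [O(h ^ 4)]. *)
Lemma taylor3_comp (F G : C -> C) (a b c d b' c' d' : C) :
  taylor3 F a b c d -> taylor3 G 0 b' c' d' ->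
  taylor3 (fun h => F (G h)) a (b * b') (b * c' + c * b' ^ 2)
    (b * d' + 2 * c * b' * c' + d * b' ^ 3).
Proof.
  intros HF HG.
  assert (H2 := taylor3_mult _ _ _ _ _ _ _ _ _ _ HG HG).
  assert (H3 := taylor3_mult _ _ _ _ _ _ _ _ _ _ HG H2).
  assert (HP := taylor3_plus _ _ _ _ _ _ _ _ _ _ (taylor3_plus _ _ _ _ _ _ _ _ _ _
    (taylor3_plus _ _ _ _ _ _ _ _ _ _ (taylor3_const a) (taylor3_scal _ b _ _ _ _ HG))
    (taylor3_scal _ c _ _ _ _ H2)) (taylor3_scal _ d _ _ _ _ H3)).
  refine (bigO_ext_all _ _ _ _ (bigO_plus _ _ _ HP
    (bigO_comp _ _ _ HF (taylor3_bigO1 _ _ _ _ HG)))).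
  intros h. simpl. ring.
Qed.

Lemma taylor3_near_nonzero (F : C -> C) (a b c d : C) :
  taylor3 F a b c d -> a <> 0 -> near0 (fun h => F h <> 0).
Proof.
  intros HF Ha.
  assert (HG : bigO 1 (fun h => F h - a)).
  { apply (taylor3_bigO1 _ b c d).
    apply (taylor3_coef _ _ _ _ _ _ _ _ _
      (taylor3_plus _ _ _ _ _ _ _ _ _ _ HF (taylor3_const (- a)))); ring. }
  assert (Hm : 0 < Cmod a) by now apply Cmod_gt_0.
  refine (near0_imp _ _ _ (bigO_near0 _ _ HG (near0_small _ Hm))).
  intros h Hh H0. rewrite H0 in Hh.
  replace (0 - a) with (- a) in Hh by ring. rewrite Cmod_opp in Hh. lra.
Qed.

(** The geometric expansion of [/ (a + h)] stops with the exact remainder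
    [h ^ 4 / (a ^ 4 (a + h))]. *)
Lemma taylor3_inv_at (a : C) : a <> 0 ->
  taylor3 (fun h => / (a + h)) (/ a) (- / a ^ 2) (/ a ^ 3) (- / a ^ 4).
Proof.
  intros Ha.
  assert (Hm : 0 < Cmod a) by now apply Cmod_gt_0.
  assert (Hhalf : 0 < Cmod a / 2) by lra.
  assert (Hlow : forall h, Cmod h < Cmod a / 2 -> Cmod a / 2 <= Cmod (a + h)).
  { intros h Hh. generalize (Cmod_triangle (a + h) (- h)). rewrite Cmod_opp.
    replace (a + h + - h) with a by ring. lra. }
  assert (HB : bigO 0 (fun h => / (a + h))).
  { exists (/ (Cmod a / 2))%R, (Cmod a / 2)%R. split; [exact Hhalf|].
    intros h Hh. specialize (Hlow h Hh). simpl. rewrite Rmult_1_r, Cmod_inv.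
    - now apply Rinv_le_contravar.
    - apply Cmod_gt_0. lra. }
  refine (bigO_ext _ _ _ _ (bigO_mult 4 0 _ _ (bigO_pow 4)
    (bigO_mult 0 0 _ _ (bigO_const (/ a ^ 4)) HB))).
  exists (Cmod a / 2)%R. split; [exact Hhalf|]. intros h Hh.
  specialize (Hlow h Hh).
  assert (a + h <> 0) by (apply Cmod_gt_0; lra).
  field. auto.
Qed.

Lemma taylor3_inv (F : C -> C) (a b c d : C) :
  taylor3 F a b c d -> a <> 0 ->
  exists b' c' d', taylor3 (fun h => / F h) (/ a) b' c' d'.
Proof.
  intros HF Ha.
  assert (HG : taylor3 (fun h => F h - a) 0 b c d).
  { apply (taylor3_coef _ _ _ _ _ _ _ _ _
      (taylor3_plus _ _ _ _ _ _ _ _ _ _ HF (taylor3_const (- a)))); ring. }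
  do 3 eexists. refine (taylor3_ext _ _ _ _ _ _ _
    (taylor3_comp _ _ _ _ _ _ _ _ _ (taylor3_inv_at a Ha) HG)).
  apply near0_all. intros h. simpl. f_equal. ring.
Qed.

Lemma near0_real (P : C -> Prop) :
  near0 P -> exists r : R, 0 < r /\ forall t : R, (0 < t < r)%R -> P (RtoC t).
Proof.
  intros [r [r0 H]]. exists r. split; [exact r0|]. intros t Ht. apply H.
  rewrite Cmod_R, Rabs_pos_eq; lra.
Qed.

Lemma bigO_monomial_zero (n : nat) (c : C) : bigO (S n) (fun h => c * h ^ n) -> c = 0.
Proof.
  intros [K H]. destruct (near0_real _ H) as [r [r0 Hr]].
  apply Cmod_eq_0, Rle_antisym; [|apply Cmod_ge_0].
  apply Rnot_lt_le. intros Hc.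
  assert (HK : 0 < Cmod c / (1 + Rabs K)).
  { apply Rdiv_lt_0_compat; [exact Hc|]. generalize (Rabs_pos K); lra. }
  set (t := (Rmin r (Cmod c / (1 + Rabs K)) / 2)%R).
  assert (t0 : (0 < t)%R).
  { unfold t. assert (0 < Rmin r (Cmod c / (1 + Rabs K))) by now apply Rmin_pos. lra. }
  assert (Htr : (t < r)%R).
  { unfold t in *. generalize (Rmin_l r (Cmod c / (1 + Rabs K))). lra. }
  assert (Htc : (t < Cmod c / (1 + Rabs K))%R).
  { unfold t in *. generalize (Rmin_r r (Cmod c / (1 + Rabs K))). lra. }
  specialize (Hr t (conj t0 Htr)).
  rewrite Cmod_mult, Cmod_pow, Cmod_R, Rabs_pos_eq in Hr by lra. simpl in Hr.
  rewrite <- Rmult_assoc in Hr. apply Rmult_le_reg_r in Hr; [|now apply pow_lt].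
  assert (Hlt : (t * (1 + Rabs K) < Cmod c)%R).
  { apply Rmult_lt_compat_r with (r := (1 + Rabs K)%R) in Htc;
      [|generalize (Rabs_pos K); lra].
    replace (Cmod c / (1 + Rabs K) * (1 + Rabs K))%R with (Cmod c) in Htc; [exact Htc|].
    field. generalize (Rabs_pos K); lra. }
  assert (K * t <= Rabs K * t) by (apply Rmult_le_compat_r; [lra|apply Rle_abs]).
  lra.
Qed.

(** The difference of two expansions is a cubic polynomial that is
    [O(h ^ 4)]; its coefficients vanish one after the other, from the lowest
    degree up. *)
Lemma taylor3_unique (F : C -> C) (a b c d a' b' c' d' : C) :
  taylor3 F a b c d -> taylor3 F a' b' c' d' ->
  a = a' /\ b = b' /\ c = c' /\ d = d'.
Proof.
  intros H H'.
  assert (HZ : forall a b c d, taylor3 (fun _ => 0) a b c d ->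
    a = 0 /\ b = 0 /\ c = 0 /\ d = 0).
  { clear. intros a b c d H.
    assert (H0 : a = 0).
    { apply (bigO_monomial_zero 0). apply (bigO_weaken _ 1) in H; [|lia].
      refine (bigO_ext_all _ _ _ _ (bigO_plus _ _ _
        (bigO_mult 0 1 _ _ (bigO_const (-1)) H)
        (bigO_mult 1 0 _ _ bigO_id (bigO_poly (- b) (- c) (- d) 0)))).
      intros h. simpl. ring. }
    subst a. split; [reflexivity|].
    assert (H0 : b = 0).
    { apply (bigO_monomial_zero 1). apply (bigO_weaken _ 2) in H; [|lia].
      refine (bigO_ext_all _ _ _ _ (bigO_plus _ _ _
        (bigO_mult 0 2 _ _ (bigO_const (-1)) H)
        (bigO_mult 2 0 _ _ (bigO_pow 2) (bigO_poly (- c) (- d) 0 0)))).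
      intros h. simpl. ring. }
    subst b. split; [reflexivity|].
    assert (H0 : c = 0).
    { apply (bigO_monomial_zero 2). apply (bigO_weaken _ 3) in H; [|lia].
      refine (bigO_ext_all _ _ _ _ (bigO_plus _ _ _
        (bigO_mult 0 3 _ _ (bigO_const (-1)) H)
        (bigO_mult 3 0 _ _ (bigO_pow 3) (bigO_poly (- d) 0 0 0)))).
      intros h. simpl. ring. }
    subst c. split; [reflexivity|].
    apply (bigO_monomial_zero 3).
    refine (bigO_ext_all _ _ _ _ (bigO_mult 0 4 _ _ (bigO_const (-1)) H)).
    intros h. simpl. ring. }
  assert (HD := taylor3_plus _ _ _ _ _ _ _ _ _ _ H (taylor3_scal _ (-1) _ _ _ _ H')).
  refine ((fun K => _) (HZ _ _ _ _ (taylor3_ext _ (fun _ => 0) _ _ _ _ _ HD))).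
  - destruct K as (Ka & Kb & Kc & Kd).
    assert (E : forall x y : C, x + (-1) * y = 0 -> x = y).
    { intros x y Hxy. replace x with (x + (-1) * y + y) by ring. rewrite Hxy. ring. }
    repeat split; now apply E.
  - apply near0_all. intros h. ring.
Qed.

Lemma expands_factor (F : C -> C) (a : nat -> C) :
  expands F a -> exists G : C -> C,
    expands G (fun n => a (S n)) /\ forall h, F h = a 0%nat + h * G h.
Proof.
  intros HF. exists (slope F a).
  split; [now apply expands_slope|]. intros h. now apply slope_spec.
Qed.

(** After four divisions by the variable the remainder is [h ^ 4] times a power
    series, which is locally bounded. *)
Lemma expands_taylor3 (F : C -> C) (a : nat -> C) :
  expands F a -> taylor3 F (a 0%nat) (a 1%nat) (a 2%nat) (a 3%nat).
Proof.
  intros HF.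
  destruct (expands_factor _ _ HF) as (F1 & H1 & E1).
  destruct (expands_factor _ _ H1) as (F2 & H2 & E2).
  destruct (expands_factor _ _ H2) as (F3 & H3 & E3).
  destruct (expands_factor _ _ H3) as (F4 & H4 & E4).
  destruct (expands_locally_bounded _ _ H4) as (r & K & r0 & HK).
  assert (HB : bigO 0 F4).
  { exists K, r. split; [exact r0|]. intros h Hh. simpl. rewrite Rmult_1_r. now apply HK. }
  refine (bigO_ext_all _ _ _ _ (bigO_mult 4 0 _ _ (bigO_pow 4) HB)).
  intros h. rewrite E1, E2, E3, E4. ring.
Qed.

Lemma taylor3_at_0 (F : C -> C) (a b c d : C) : taylor3 F a b c d -> F 0 = a.
Proof.
  intros [K H]. apply near0_at_0 in H. rewrite Cmod_0 in H.
  assert (E : F 0 - (a + b * 0 + c * 0 ^ 2 + d * 0 ^ 3) = F 0 - a) by ring.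
  rewrite E in H. assert (E0 : F 0 - a = 0).
  { apply Cmod_eq_0, Rle_antisym; [|apply Cmod_ge_0]. simpl in H. lra. }
  replace (F 0) with (F 0 - a + a) by ring. rewrite E0. ring.
Qed.

(** * Functions with Taylor expansions throughout the disc *)

Definition has_taylor_at (f : C -> C) (z : C) : Prop :=
  exists a b c d, taylor3 (fun h => f (z + h)) a b c d.

(** This property replaces analyticity: it is all that the maximum principle
    uses, and its stability under the algebraic operations is immediate,
    whereas power series would have to be multiplied and inverted. *)
Definition smooth_on_disc (f : C -> C) : Prop :=
  forall z : C, unit_disc z -> has_taylor_at f z.

Lemma has_taylor_continuous (f : C -> C) (z : C) (eps : R) :
  has_taylor_at f z -> 0 < eps -> near0 (fun h => Cmod (f (z + h) - f z) < eps).
Proof.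
  intros (a & b & c & d & H) He.
  assert (E : f z = a).
  { rewrite <- (taylor3_at_0 _ _ _ _ _ H). f_equal. ring. }
  apply (bigO_near0 (fun h => f (z + h) - f z) (fun k => Cmod k < eps));
    [|now apply near0_small].
  apply (taylor3_bigO1 _ b c d). rewrite E.
  apply (taylor3_coef _ _ _ _ _ _ _ _ _
      (taylor3_plus _ _ _ _ _ _ _ _ _ _ H (taylor3_const (- a)))); ring.
Qed.

Lemma has_taylor_at_ext (f g : C -> C) (z : C) :
  near0 (fun h => f (z + h) = g (z + h)) -> has_taylor_at f z -> has_taylor_at g z.
Proof.
  intros H (a & b & c & d & Hf). exists a, b, c, d. exact (taylor3_ext _ _ _ _ _ _ H Hf).
Qed.

Lemma has_taylor_at_plus (f g : C -> C) (z : C) :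
  has_taylor_at f z -> has_taylor_at g z -> has_taylor_at (fun x => f x + g x) z.
Proof.
  intros (a & b & c & d & Hf) (a' & b' & c' & d' & Hg). do 4 eexists.
  exact (taylor3_plus _ _ _ _ _ _ _ _ _ _ Hf Hg).
Qed.

Lemma has_taylor_at_mult (f g : C -> C) (z : C) :
  has_taylor_at f z -> has_taylor_at g z -> has_taylor_at (fun x => f x * g x) z.
Proof.
  intros (a & b & c & d & Hf) (a' & b' & c' & d' & Hg). do 4 eexists.
  exact (taylor3_mult _ _ _ _ _ _ _ _ _ _ Hf Hg).
Qed.

Lemma has_taylor_at_const (c z : C) : has_taylor_at (fun _ => c) z.
Proof. do 4 eexists. exact (taylor3_const c). Qed.

Lemma has_taylor_at_id (z : C) : has_taylor_at (fun x => x) z.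
Proof. do 4 eexists. exact (taylor3_plus _ _ _ _ _ _ _ _ _ _ (taylor3_const z) taylor3_id). Qed.

Lemma has_taylor_at_opp_arg (f : C -> C) (z : C) :
  has_taylor_at f (- z) -> has_taylor_at (fun x => f (- x)) z.
Proof.
  intros (a & b & c & d & Hf). do 4 eexists.
  assert (Hm : taylor3 (fun h => (-1) * h) 0 (-1) 0 0).
  { apply (taylor3_coef _ _ _ _ _ _ _ _ _ (taylor3_scal _ (-1) _ _ _ _ taylor3_id)); ring. }
  refine (taylor3_ext _ _ _ _ _ _ _ (taylor3_comp _ _ _ _ _ _ _ _ _ Hf Hm)).
  apply near0_all. intros h. f_equal. ring.
Qed.

Lemma has_taylor_at_inv (f : C -> C) (z : C) :
  has_taylor_at f z -> f z <> 0 -> has_taylor_at (fun x => / f x) z.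
Proof.
  intros (a & b & c & d & Hf) Hz.
  assert (E : f z = a).
  { rewrite <- (taylor3_at_0 _ _ _ _ _ Hf). f_equal. ring. }
  rewrite E in Hz. destruct (taylor3_inv _ _ _ _ _ Hf Hz) as (b' & c' & d' & H).
  exists (/ a), b', c', d'. exact H.
Qed.

Lemma smooth_of_analytic (f : C -> C) : analytic_on_disc f -> smooth_on_disc f.
Proof.
  intros Hf z Hz. destruct (Hf z Hz) as [a Ha]. do 4 eexists.
  exact (expands_taylor3 _ _ (expands_of_has_power_series _ _ _ Ha)).
Qed.

(** The quotient has a power series at the origin, and away from it is a
    product of functions with Taylor expansions. *)
Lemma smooth_factor (f : C -> C) (a : nat -> C) :
  smooth_on_disc f -> expands f a ->
  exists g : C -> C, smooth_on_disc g /\ expands g (fun n => a (S n)) /\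
    forall z, f z = a 0%nat + z * g z.
Proof.
  intros Hs Hf. assert (Hg := expands_slope _ _ Hf).
  exists (slope f a). split; [|split; [exact Hg|intros z; now apply slope_spec]].
  intros z Hz. destruct (Ceq_dec z 0) as [->|z0].
  + do 4 eexists.
    refine (taylor3_ext _ _ _ _ _ _ _ (expands_taylor3 _ _ Hg)).
    apply near0_all. intros h. f_equal. ring.
  + apply (has_taylor_at_ext (fun x => (f x + - a 0%nat) * / x)).
    * refine (near0_imp _ _ _ (taylor3_near_nonzero _ _ _ _ _
        (taylor3_plus _ _ _ _ _ _ _ _ _ _ (taylor3_const z) taylor3_id) _)).
      -- intros h Hh. unfold slope. destruct (Ceq_dec (z + h) 0) as [E|_]; [easy|reflexivity].
      -- replace (z + 0) with z by ring. exact z0.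
    * apply has_taylor_at_mult.
      -- apply has_taylor_at_plus; [now apply Hs|apply has_taylor_at_const].
      -- apply has_taylor_at_inv; [apply has_taylor_at_id|exact z0].
Qed.

(** * The maximum principle *)

Lemma list_argmax (T : Type) (P : T -> Prop) (q : T -> R) (l : list T) :
  (exists t, In t l /\ P t) ->
  exists t, P t /\ forall s, In s l -> P s -> q s <= q t.
Proof.
  induction l as [|x l IH]; intros [t [Ht HP]]; [destruct Ht|].
  destruct (classic (exists t, In t l /\ P t)) as [He|He].
  - destruct (IH He) as [y [Py Hy]].
    destruct (classic (P x /\ q y < q x)) as [[Px Hx]|Hx].
    + exists x. split; [exact Px|]. intros s [->|Hs] Ps; [lra|].
      specialize (Hy s Hs Ps). lra.
    + exists y. split; [exact Py|]. intros s [->|Hs] Ps; [|auto].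
      apply Rnot_lt_le. tauto.
  - exists t. split; [exact HP|]. intros s Hs Ps.
    destruct Ht as [->|Ht]; [|exfalso; eauto].
    destruct Hs as [->|Hs]; [lra|exfalso; eauto].
Qed.

(** An upper semicontinuous function attains its maximum on a closed disc.
    Otherwise each [z] has a neighbourhood on which [psi < psi w] for some [w]
    of the disc.  Finitely many such neighbourhoods cover the disc; the [w] with
    the largest value belongs to one of them, and the [w] of that neighbourhood
    has a larger value still. *)
Lemma closed_disc_max (psi : C -> R) (r : R) :
  0 <= r ->
  (forall z, Cmod z <= r -> forall y, psi z < y -> near0 (fun h => psi (z + h) < y)) ->
  exists z0, Cmod z0 <= r /\ forall z, Cmod z <= r -> psi z <= psi z0.
Proof.
  intros r0 Husc. apply NNPP. intros Hno.
  assert (Hup : forall z, Cmod z <= r -> exists w, Cmod w <= r /\ psi z < psi w).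
  { intros z Hz. apply NNPP. intros Hw. apply Hno. exists z. split; [exact Hz|].
    intros w Hwr. apply Rnot_lt_le. intros Hlt. apply Hw. eauto. }
  assert (Hloc : forall z, exists p : posreal * C,
    (Cmod z <= r -> Cmod (snd p) <= r) /\
    forall h, Cmod h < 2 * fst p ->
      (Cmod z <= r -> psi (z + h) < psi (snd p)) /\ (r < Cmod z -> r < Cmod (z + h))).
  { intros z. destruct (Rle_lt_dec (Cmod z) r) as [Hz|Hz].
    - destruct (Hup z Hz) as [w [Hw Hlt]].
      destruct (Husc z Hz _ Hlt) as [d [d0 Hd]].
      assert (d2 : 0 < d / 2) by lra.
      exists (mkposreal _ d2, w). simpl. split; [auto|]. intros h Hh.
      split; [|lra]. intros _. apply Hd. lra.
    - assert (d2 : 0 < (Cmod z - r) / 2) by lra.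
      exists (mkposreal _ d2, RtoC 0). simpl. split; [lra|]. intros h Hh.
      split; [lra|]. intros _.
      generalize (Cmod_triangle (z + h) (- h)). rewrite Cmod_opp.
      replace (z + h + - h) with z by ring. lra. }
  set (pick := fun z => proj1_sig (constructive_indefinite_description _ (Hloc z))).
  assert (Hpick : forall z, (Cmod z <= r -> Cmod (snd (pick z)) <= r) /\
    forall h, Cmod h < 2 * fst (pick z) ->
      (Cmod z <= r -> psi (z + h) < psi (snd (pick z))) /\
      (r < Cmod z -> r < Cmod (z + h))).
  { intros z. exact (proj2_sig (constructive_indefinite_description _ (Hloc z))). }
  clearbody pick. clear Hloc Hup Hno Husc.
  (* Points of the square [-r, r] ^ 2, in the encoding of [compactness_list]. *)
  set (pt := fun t : R * (R * unit) => (fst t, fst (snd t)) : C).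
  apply (compactness_list 2 (- r, (- r, tt))%R (r, (r, tt)) (fun t => fst (pick (pt t)))).
  intros [l Hl].
  assert (Hcover : forall w, Cmod w <= r ->
    exists t, In t l /\ Cmod (pt t) <= r /\ psi w < psi (snd (pick (pt t)))).
  { intros [x y] Hw.
    assert (Hxy : Rabs x <= r /\ Rabs y <= r).
    { generalize (Rmax_Cmod (x, y)). simpl. intros Hm.
      generalize (Rmax_l (Rabs x) (Rabs y)) (Rmax_r (Rabs x) (Rabs y)). lra. }
    destruct (Hl (x, (y, tt))) as [[u [v []]] [Hin [_ Hc]]].
    { simpl. destruct Hxy as [Hx Hy]. apply Rabs_le_between in Hx, Hy. tauto. }
    exists (u, (v, tt)). split; [exact Hin|].
    simpl in Hc. unfold pt in *. simpl in *. destruct Hc as (Hx & Hy & _).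
    destruct (Hpick (u, v)) as [_ Hh].
    specialize (Hh (x - u, y - v)%R).
    assert (E : (u, v) + (x - u, y - v)%R = (x, y)).
    { unfold Cplus. simpl. f_equal; ring. }
    rewrite E in Hh.
    assert (Hd : Cmod (x - u, y - v)%R < 2 * fst (pick (u, v))).
    { apply Rle_lt_trans with (1 := Cmod_2Rmax _). simpl.
      set (m := Rmax (Rabs (x - u)) (Rabs (y - v))).
      assert (Hm : m < fst (pick (u, v))) by now apply Rmax_lub_lt.
      assert (Hm0 : 0 <= m).
      { apply Rle_trans with (2 := Rmax_l _ _), Rabs_pos. }
      assert (H2 : sqrt 2 <= 2).
      { rewrite <- (sqrt_square 2) at 2 by lra. apply sqrt_le_1; lra. }
      apply Rle_lt_trans with (2 * m)%R; [|lra].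
      now apply Rmult_le_compat_r. }
    destruct (Hh Hd) as [H1 H2].
    assert (Huv : Cmod (u, v) <= r).
    { apply Rnot_lt_le. intros Hlt. specialize (H2 Hlt). lra. }
    auto. }
  destruct (list_argmax _ (fun t => Cmod (pt t) <= r) (fun t => psi (snd (pick (pt t)))) l)
    as [t [Ht Hmax]].
  { destruct (Hcover 0) as [t [H1 [H2 _]]]; [now rewrite Cmod_0|]. eauto. }
  destruct (Hcover (snd (pick (pt t)))) as [s [Hs [Hsr Hlt]]].
  { now apply Hpick. }
  specialize (Hmax s Hs Hsr). lra.
Qed.

Lemma Cmod_sqr (z : C) : (Cmod z ^ 2 = fst z ^ 2 + snd z ^ 2)%R.
Proof. exact (Cmod2_alt z). Qed.

Lemma Re_plus_ge (z w : C) : Re z - Cmod w <= Re (z + w).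
Proof.
  generalize (re_le_Cmod w). intros H. apply Rabs_le_between in H.
  change (Re (z + w)) with (Re z + Re w)%R. lra.
Qed.

(** For small [t > 0] the points [z0 + i ^ k t], [k = 0, 1, 2, 3], average the
    monomials [h], [h ^ 2], [h ^ 3] to zero, so that the mean of [Re f] is
    [Re (f z0) + O(t ^ 4)], while the mean of [eps |z|^2] exceeds its value at
    [z0] by [eps t ^ 2]. *)
Lemma no_interior_max (f : C -> C) (z0 : C) (eps : R) :
  has_taylor_at f z0 -> 0 < eps ->
  ~ near0 (fun h => Re (f (z0 + h)) + eps * Cmod (z0 + h) ^ 2
      <= Re (f z0) + eps * Cmod z0 ^ 2).
Proof.
  intros (a & b & c & d & H) He Hmax.
  assert (E : f z0 = a).
  { rewrite <- (taylor3_at_0 _ _ _ _ _ H). f_equal. ring. }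
  destruct H as [K H].
  destruct (near0_and _ _ Hmax H) as [r [r0 Hr]]. clear H Hmax.
  set (t := (Rmin r (Rmin 1 (eps / (1 + Rabs K))) / 2)%R).
  assert (HK : 0 < eps / (1 + Rabs K)).
  { apply Rdiv_lt_0_compat; [exact He|]. generalize (Rabs_pos K); lra. }
  assert (Ht : (0 < t < r)%R /\ t < 1 /\ t < eps / (1 + Rabs K)).
  { assert (0 < Rmin r (Rmin 1 (eps / (1 + Rabs K)))).
    { repeat apply Rmin_pos; lra. }
    generalize (Rmin_l r (Rmin 1 (eps / (1 + Rabs K))))
      (Rmin_r r (Rmin 1 (eps / (1 + Rabs K))))
      (Rmin_l 1 (eps / (1 + Rabs K))) (Rmin_r 1 (eps / (1 + Rabs K))).
    unfold t. lra. }
  clearbody t. destruct Ht as ((t0 & tr) & t1 & te).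
  assert (Hpt : forall h, Cmod h = t ->
    Re (a + b * h + c * h ^ 2 + d * h ^ 3) - K * t ^ 4 + eps * Cmod (z0 + h) ^ 2
    <= Re a + eps * Cmod z0 ^ 2).
  { intros h Hh. destruct (Hr h ltac:(lra)) as [H1 H2]. rewrite Hh in H2.
    rewrite E in H1.
    generalize (Re_plus_ge (a + b * h + c * h ^ 2 + d * h ^ 3)
      (f (z0 + h) - (a + b * h + c * h ^ 2 + d * h ^ 3))).
    replace (a + b * h + c * h ^ 2 + d * h ^ 3 +
      (f (z0 + h) - (a + b * h + c * h ^ 2 + d * h ^ 3))) with (f (z0 + h)) by ring.
    lra. }
  assert (Hmt : Cmod (RtoC t) = t) by (rewrite Cmod_R, Rabs_pos_eq; lra).
  assert (P1 := Hpt (RtoC t) Hmt).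
  assert (P2 := Hpt (- RtoC t) ltac:(now rewrite Cmod_opp)).
  assert (P3 := Hpt (Ci * RtoC t) ltac:(now rewrite Cmod_mult, Cmod_Ci, Rmult_1_l)).
  assert (P4 := Hpt (- (Ci * RtoC t))
    ltac:(now rewrite Cmod_opp, Cmod_mult, Cmod_Ci, Rmult_1_l)).
  rewrite !Cmod_sqr in P1, P2, P3, P4.
  destruct a as [a1 a2], b as [b1 b2], c as [c1 c2], d as [d1 d2], z0 as [x y].
  simpl in P1, P2, P3, P4.
  assert (Hsum : eps * (t * t) <= K * (t * t * (t * t))) by lra.
  assert (Hlt : t * (1 + Rabs K) < eps).
  { apply Rmult_lt_compat_r with (r := (1 + Rabs K)%R) in te;
      [|generalize (Rabs_pos K); lra].
    replace (eps / (1 + Rabs K) * (1 + Rabs K))%R with eps in te; [exact te|].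
    field. generalize (Rabs_pos K); lra. }
  rewrite <- Rmult_assoc in Hsum.
  assert (tt0 : 0 < t * t) by now apply Rmult_lt_0_compat.
  assert (H5 : eps <= K * (t * t)).
  { apply Rmult_le_reg_r with (t * t)%R; [exact tt0|]. lra. }
  assert (H6 : K * (t * t) <= Rabs K * t).
  { apply Rle_trans with (Rabs K * (t * t))%R.
    - apply Rmult_le_compat_r; [lra|apply Rle_abs].
    - apply Rmult_le_compat_l; [apply Rabs_pos|].
      rewrite <- (Rmult_1_r t) at 3. apply Rmult_le_compat_l; lra. }
  lra.
Qed.

(** If [Re f] exceeded [M] at [z], then for small [eps] the maximum of
    [Re f + eps |z|^2] would be interior. *)
Lemma Re_maximum_principle (f : C -> C) (r M : R) :
  smooth_on_disc f -> (0 <= r < 1)%R ->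
  (forall z, Cmod z = r -> Re (f z) <= M) ->
  forall z, Cmod z <= r -> Re (f z) <= M.
Proof.
  intros Hf Hr HM z Hz. apply Rnot_lt_le. intros Hlt.
  set (eps := ((Re (f z) - M) / 2)%R).
  assert (He : 0 < eps) by (unfold eps; lra).
  destruct (closed_disc_max (fun w => Re (f w) + eps * Cmod w ^ 2)%R r) as [z0 [Hz0 Hmax]].
  - lra.
  - intros w Hw y Hy.
    assert (Hd : 0 < (y - (Re (f w) + eps * Cmod w ^ 2)) / 2) by lra.
    set (delta := ((y - (Re (f w) + eps * Cmod w ^ 2)) / 2)%R) in *.
    assert (Hd3 : 0 < delta / (3 * eps)) by (apply Rdiv_lt_0_compat; lra).
    refine (near0_imp _ _ _ (near0_and _ _
      (has_taylor_continuous f w delta (Hf w _) Hd)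
      (near0_and _ _ (near0_small 1 Rlt_0_1) (near0_small _ Hd3)))).
    2:{ unfold unit_disc. lra. }
    intros h (H1 & H2 & H3).
    assert (H4 : Re (f (w + h)) <= Re (f w) + Cmod (f (w + h) - f w)).
    { generalize (Re_plus_ge (f (w + h)) (- (f (w + h) - f w))). rewrite Cmod_opp.
      replace (f (w + h) + - (f (w + h) - f w)) with (f w) by ring. lra. }
    assert (H5 : Cmod (w + h) ^ 2 <= Cmod w ^ 2 + 3 * Cmod h).
    { generalize (Cmod_triangle w h) (Cmod_ge_0 w) (Cmod_ge_0 h) (Cmod_ge_0 (w + h)).
      intros. nra. }
    assert (H6 : 3 * eps * Cmod h < delta).
    { apply Rmult_lt_compat_l with (r := (3 * eps)%R) in H3; [|lra].
      replace (3 * eps * (delta / (3 * eps)))%R with delta in H3 by (field; lra).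
      exact H3. }
    assert (H7 : eps * Cmod (w + h) ^ 2 <= eps * (Cmod w ^ 2 + 3 * Cmod h)).
    { apply Rmult_le_compat_l; lra. }
    unfold delta in *. lra.
  - assert (Hz' := Hmax z Hz). simpl in Hz'.
    destruct (Rle_lt_or_eq_dec _ _ Hz0) as [Hin|Hon].
    + apply (no_interior_max f z0 eps); [apply Hf; unfold unit_disc; lra|exact He|].
      exists (r - Cmod z0)%R. split; [lra|]. intros h Hh. apply Hmax.
      generalize (Cmod_triangle z0 h). lra.
    + specialize (HM z0 Hon). rewrite Hon in Hz'.
      assert (eps * r ^ 2 <= eps * 1) by (apply Rmult_le_compat_l; nra).
      assert (0 <= eps * Cmod z ^ 2).
      { apply Rmult_le_pos; [lra|apply pow2_ge_0]. }
      simpl pow in *. unfold eps in *. lra.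
Qed.

(** * Coefficients of Schwarz functions *)

(** The Schwarz lemma for a function [z ^ 2 G z] bounded by 1: on the circle of
    radius [r] one has [|G| <= 1 / r ^ 2], so [|G 0| <= 1 / r ^ 2] by the maximum
    principle for [Re (conj (G 0) G)], and [r] tends to 1. *)
Lemma Cmod_at_0_le_1 (G : C -> C) :
  smooth_on_disc G ->
  (forall z, unit_disc z -> Cmod (z ^ 2 * G z) <= 1) -> Cmod (G 0) <= 1.
Proof.
  intros HG HB. apply Rnot_lt_le. intros Hlt.
  set (m := Cmod (G 0)) in *.
  (* By the inequality of means, r ^ 2 > / m. *)
  set (r := ((1 + / m) / 2)%R).
  assert (Hi : (0 < / m < 1)%R).
  { split; [apply Rinv_0_lt_compat; lra|]. rewrite <- Rinv_1. apply Rinv_lt_contravar; lra. }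
  assert (Hr : (0 < r < 1)%R) by (unfold r; lra).
  assert (Hr2 : 1 < m * r ^ 2).
  { assert (Hmi : (m * / m = 1)%R) by (field; lra).
    replace (m * r ^ 2)%R with (1 + m * (1 - / m) ^ 2 / 4)%R.
    - assert (0 < m * (1 - / m) ^ 2).
      { apply Rmult_lt_0_compat; [lra|]. apply pow_lt. lra. }
      lra.
    - unfold r. field. lra. }
  assert (HS : smooth_on_disc (fun z => Cconj (G 0) * G z)).
  { intros z Hz. apply has_taylor_at_mult; [apply has_taylor_at_const|now apply HG]. }
  assert (Hmax := Re_maximum_principle _ r (m / r ^ 2) HS ltac:(lra)).
  assert (H0 : Re (Cconj (G 0) * G 0) <= m / r ^ 2).
  { apply Hmax; [|rewrite Cmod_0; lra]. intros z Hz.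
    apply Rle_trans with (1 := Rle_abs _), Rle_trans with (1 := re_le_Cmod _).
    rewrite Cmod_mult, Cmod_conj. fold m.
    specialize (HB z). rewrite Cmod_mult, Cmod_pow, Hz in HB.
    specialize (HB ltac:(unfold unit_disc; lra)).
    assert (0 < r ^ 2) by (apply pow_lt; lra).
    unfold Rdiv. apply Rmult_le_compat_l; [lra|].
    apply Rmult_le_reg_l with (r ^ 2)%R; [assumption|]. rewrite Rinv_r; lra. }
  replace (Re (Cconj (G 0) * G 0)) with (m ^ 2)%R in H0.
  2:{ rewrite Cmult_comm. unfold m. rewrite Cmod_sqr. simpl. ring. }
  assert (0 < r ^ 2) by (apply pow_lt; lra).
  apply Rmult_le_compat_r with (r := (r ^ 2)%R) in H0; [|lra].
  replace (m / r ^ 2 * r ^ 2)%R with m in H0 by (field; lra).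
  nra.
Qed.

(** The map [u -> (1 + u) / (1 - u)] sends the disc to the right half-plane,
    which is convex; [(u + v - 2 u v) / (2 - u - v)] corresponds to the midpoint
    of the images of [u] and [v]. *)
Lemma Cmod_half_plane_average (u v : C) :
  unit_disc u -> unit_disc v -> Cmod (u + v - 2 * u * v) <= Cmod (2 - u - v).
Proof.
  unfold unit_disc. intros Hu Hv.
  assert (Hq : forall z, Cmod z < 1 -> fst z ^ 2 + snd z ^ 2 < 1).
  { intros z Hz. rewrite <- Cmod_sqr. generalize (Cmod_ge_0 z). intros. nra. }
  apply Hq in Hu, Hv.
  apply Rsqr_incr_0_var; [|apply Cmod_ge_0]. rewrite !Rsqr_pow2.
  rewrite !Cmod_sqr. destruct u as [a b], v as [c d]. simpl in *.
  (* A = |1 - u|^2 and B = |1 - v|^2; |u| < 1 means A < 2 Re (1 - u). *)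
  set (A := ((1 - a) * (1 - a) + b * b)%R).
  set (B := ((1 - c) * (1 - c) + d * d)%R).
  assert (HA : A <= 2 * (1 - a)) by (unfold A; nra).
  assert (HB : B <= 2 * (1 - c)) by (unfold B; nra).
  assert (A0 : 0 <= A) by (unfold A; nra).
  assert (B0 : 0 <= B) by (unfold B; nra).
  enough (0 <= 4 * (A * (1 - c) + B * (1 - a) - A * B)) by (unfold A, B in *; lra).
  nra.
Qed.

(** Write [w z = z h z] and [h z = u 1 + z e z].  The first bound is the Schwarz
    lemma for [h].  The second is the Schwarz lemma for
    [(w z + w (-z) - 2 w z w (-z)) / (2 - w z - w (-z))], whose numerator is
    [z ^ 2 (e z + e (-z) + 2 h z h (-z))]. *)
Lemma schwarz_coefficients (w : C -> C) (u : nat -> C) :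
  analytic_on_disc w -> (forall z, unit_disc z -> unit_disc (w z)) -> w 0 = 0 ->
  expands w u -> Cmod (u 1%nat) <= 1 /\ Cmod (u 2%nat + u 1%nat ^ 2) <= 1.
Proof.
  intros Hw HD Hw0 Hu. apply smooth_of_analytic in Hw.
  destruct (smooth_factor _ _ Hw Hu) as (h & Hh & Hhe & Eh).
  destruct (smooth_factor _ _ Hh Hhe) as (e & He & Hee & Ee).
  simpl in Ee.
  assert (Eu0 : u 0%nat = 0) by now rewrite <- (expands_at_0 _ _ Hu).
  assert (Eh0 := expands_at_0 _ _ Hhe). simpl in Eh0.
  assert (Ee0 := expands_at_0 _ _ Hee). simpl in Ee0.
  assert (Hopp : forall z, unit_disc z -> unit_disc (- z)).
  { unfold unit_disc. intros z. now rewrite Cmod_opp. }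
  split.
  - rewrite <- Eh0. apply Cmod_at_0_le_1; [exact Hh|]. intros z Hz.
    replace (z ^ 2 * h z) with (z * w z) by (rewrite Eh, Eu0; ring).
    rewrite Cmod_mult. specialize (HD z Hz). unfold unit_disc in *.
    generalize (Cmod_ge_0 z) (Cmod_ge_0 (w z)). nra.
  - set (G := fun z => (e z + e (- z) + 2 * (h z * h (- z))) * / (2 + (-1) * w z + (-1) * w (- z))).
    assert (Hden : forall z, unit_disc z -> 2 + (-1) * w z + (-1) * w (- z) <> 0).
    { intros z Hz E. assert (H1 := HD z Hz). assert (H2 := HD _ (Hopp z Hz)).
      unfold unit_disc in *.
      generalize (Cmod_triangle (w z) (w (- z))).
      replace (w z + w (- z)) with (RtoC 2).
      - rewrite Cmod_R, Rabs_pos_eq; lra.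
      - replace (RtoC 2) with (2 + (-1) * w z + (-1) * w (- z) + (w z + w (- z))) by ring.
        rewrite E. ring. }
    replace (u 2%nat + u 1%nat ^ 2) with (G 0).
    2:{ unfold G. replace (- 0) with (RtoC 0) by ring. rewrite Hw0, Eh0, Ee0. field. }
    apply Cmod_at_0_le_1.
    + intros z Hz. apply has_taylor_at_mult.
      * apply has_taylor_at_plus.
        -- apply has_taylor_at_plus; [now apply He|].
           apply has_taylor_at_opp_arg; auto.
        -- apply has_taylor_at_mult; [apply has_taylor_at_const|].
           apply has_taylor_at_mult; [now apply Hh|].
           apply has_taylor_at_opp_arg; auto.
      * apply (has_taylor_at_inv (fun z => 2 + (-1) * w z + (-1) * w (- z))); [|auto].
        apply has_taylor_at_plus; [apply has_taylor_at_plus|].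
        -- apply has_taylor_at_const.
        -- apply has_taylor_at_mult; [apply has_taylor_at_const|auto].
        -- apply has_taylor_at_mult; [apply has_taylor_at_const|].
           apply has_taylor_at_opp_arg; auto.
    + intros z Hz. specialize (Hden z Hz).
      replace (z ^ 2 * G z) with
        ((w z + w (- z) - 2 * w z * w (- z)) / (2 - w z - w (- z))).
      * assert (Hden' : 2 - w z - w (- z) <> 0).
        { intros E. apply Hden. rewrite <- E. ring. }
        rewrite Cmod_div by exact Hden'.
        assert (0 < Cmod (2 - w z - w (- z))) by now apply Cmod_gt_0.
        apply Rmult_le_reg_r with (Cmod (2 - w z - w (- z))); [assumption|].
        unfold Rdiv. rewrite Rmult_assoc, Rinv_l, Rmult_1_r, Rmult_1_l by lra.
        apply Cmod_half_plane_average; auto.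
      * unfold G, Cdiv.
        replace (2 + (-1) * w z + (-1) * w (- z)) with (2 - w z - w (- z)) by ring.
        rewrite (Cmult_assoc (z ^ 2)). f_equal.
        rewrite (Eh z), (Eh (- z)), Eu0.
        replace (e z + e (- z) + 2 * (h z * h (- z)))
          with (e z + e (- z) + 2 * (h z * h (- z))) by ring.
        assert (E2 : h z - h (- z) = z * (e z + e (- z))).
        { rewrite (Ee z), (Ee (- z)). ring. }
        replace (z ^ 2 * (e z + e (- z) + 2 * (h z * h (- z))))
          with (z * (z * (e z + e (- z))) + 2 * z ^ 2 * (h z * h (- z))) by ring.
        rewrite <- E2. ring.
Qed.

(** * Coefficient relations and estimates *)

Lemma Cminus_eq_0 (x y : C) : x - y = 0 -> x = y.
Proof. intros H. replace x with (x - y + y) by ring. rewrite H. ring. Qed.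

(** The fourth coefficient of the second derivative is left unnamed: the
    derivative always occurs multiplied by the variable. *)
Lemma expands_derive_taylor3 (f : C -> C) (a : nat -> C) :
  expands f a ->
  taylor3 (C_derive f) (a 1%nat) (2 * a 2%nat) (3 * a 3%nat) (4 * a 4%nat) /\
  exists d, taylor3 (C_derive (C_derive f)) (2 * a 2%nat) (6 * a 3%nat) (12 * a 4%nat) d.
Proof.
  intros Hf. assert (H1 := expands_derive _ _ Hf). assert (H2 := expands_derive _ _ H1).
  apply expands_taylor3 in H1, H2. split; [|eexists];
    (eapply taylor3_coef; [eassumption| | | |]);
    rewrite ?INR_IZR_INZ; simpl IZR; try ring; reflexivity.
Qed.

(** Clearing denominators in [mocanu alpha f = phi o w] gives
    [phi(w) f f' = (1 - alpha) z f'^2 + alpha (f f' + z f'' f)] near the origin,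
    and the coefficients of [z ^ 2] and [z ^ 3] are the two relations. *)
Lemma mocanu_coefficients (alpha : R) (phi f w : C -> C) (B a u : nat -> C) :
  expands phi B -> B 0%nat = 1 ->
  expands f a -> a 0%nat = 0 -> a 1%nat = 1 ->
  expands w u -> u 0%nat = 0 ->
  near0 (fun z => mocanu alpha f z = phi (w z)) ->
  (1 + alpha) * a 2%nat = B 1%nat * u 1%nat /\
  2 * (1 + 2 * alpha) * a 3%nat - (1 + 3 * alpha) * a 2%nat ^ 2
    = B 1%nat * u 2%nat + B 2%nat * u 1%nat ^ 2.
Proof.
  intros Hphi HB0 Hf Ha0 Ha1 Hw Hu0 Heq.
  destruct (expands_derive_taylor3 _ _ Hf) as [Td [d2 Tdd]].
  destruct (expands_factor _ _ Hf) as (G & HG & EG).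
  assert (Tf := expands_taylor3 _ _ Hf).
  assert (Tphi := expands_taylor3 _ _ Hphi).
  assert (Tw := expands_taylor3 _ _ Hw).
  assert (C10 : RtoC 1 <> 0) by (intros E; injection E; lra).
  rewrite Ha0, Ha1 in *. rewrite HB0 in *. rewrite Hu0 in *.
  assert (NG := expands_taylor3 _ _ HG). simpl in NG. rewrite Ha1 in NG.
  apply taylor3_near_nonzero in NG; [|exact C10].
  assert (Nd := taylor3_near_nonzero _ _ _ _ _ Td C10).
  assert (TL := taylor3_mult _ _ _ _ _ _ _ _ _ _
    (taylor3_comp _ _ _ _ _ _ _ _ _ Tphi Tw) (taylor3_mult _ _ _ _ _ _ _ _ _ _ Tf Td)).
  assert (Tff := taylor3_mult _ _ _ _ _ _ _ _ _ _ taylor3_id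
    (taylor3_mult _ _ _ _ _ _ _ _ _ _ Td Td)).
  assert (Tffd := taylor3_mult _ _ _ _ _ _ _ _ _ _ Tf Td).
  assert (Tfdd := taylor3_mult _ _ _ _ _ _ _ _ _ _ taylor3_id
    (taylor3_mult _ _ _ _ _ _ _ _ _ _ Tdd Tf)).
  assert (TR := taylor3_plus _ _ _ _ _ _ _ _ _ _
    (taylor3_scal _ (1 - alpha) _ _ _ _ Tff)
    (taylor3_scal _ alpha _ _ _ _ (taylor3_plus _ _ _ _ _ _ _ _ _ _ Tffd Tfdd))).
  refine ((fun TL' => _) (taylor3_ext _ _ _ _ _ _ _ TL)).
  1: destruct (taylor3_unique _ _ _ _ _ _ _ _ _ TL' TR) as (_ & _ & E2 & E3).
  2:{ refine (near0_imp _ _ _ (near0_and _ _ Heq (near0_and _ _ NG Nd))).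
      intros h (H1 & H2 & H3). rewrite <- H1. unfold mocanu, starlike_quotient.
      destruct (Ceq_dec h 0) as [->|h0].
      - rewrite (EG 0). ring.
      - assert (Hfh : f h <> 0).
        { rewrite EG. replace (0 + h * G h) with (h * G h) by ring.
          now apply Cmult_neq_0. }
        field. auto. }
  assert (F1 : (1 + alpha) * a 2%nat = B 1%nat * u 1%nat).
  { apply Cminus_eq_0.
    match type of E2 with ?P = ?Q =>
      transitivity (Q - P); [ring|rewrite E2; ring] end. }
  split; [exact F1|].
  apply Cminus_eq_0.
  match type of E3 with ?P = ?Q =>
    transitivity ((Q - P) + 3 * a 2%nat * (B 1%nat * u 1%nat - (1 + alpha) * a 2%nat));
      [ring|rewrite E3, F1; ring] end.
Qed.

Lemma inverse_coefficients (f g : C -> C) (a b : nat -> C) :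
  expands f a -> a 0%nat = 0 -> a 1%nat = 1 -> expands g b -> b 0%nat = 0 ->
  near0 (fun w => f (g w) = w) ->
  b 1%nat = 1 /\ b 2%nat = - a 2%nat /\ b 3%nat = 2 * a 2%nat ^ 2 - a 3%nat.
Proof.
  intros Hf Ha0 Ha1 Hg Hb0 Hfg.
  assert (Tf := expands_taylor3 _ _ Hf). assert (Tg := expands_taylor3 _ _ Hg).
  rewrite Ha0, Ha1 in Tf. rewrite Hb0 in Tg.
  destruct (taylor3_unique _ _ _ _ _ _ _ _ _
    (taylor3_ext _ _ _ _ _ _ Hfg (taylor3_comp _ _ _ _ _ _ _ _ _ Tf Tg)) taylor3_id)
    as (_ & E1 & E2 & E3).
  assert (F1 : b 1%nat = 1) by (rewrite <- E1; ring).
  rewrite F1 in E2, E3.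
  assert (F2 : b 2%nat = - a 2%nat).
  { apply Cminus_eq_0. rewrite <- E2. ring. }
  rewrite F2 in E3. split; [exact F1|split; [exact F2|]].
  apply Cminus_eq_0. rewrite <- E3. ring.
Qed.

Lemma Cmod_real (x : R) : 0 <= x -> Cmod (RtoC x) = x.
Proof. intros H. now rewrite Cmod_R, Rabs_pos_eq. Qed.

(** Adding the two relations of order two eliminates [a3]; their combination
    with weights [3 + 5 alpha] and [1 + 3 alpha] eliminates [a2]. *)
Lemma coefficient_estimates (alpha B1 : R) (B2 a2 a3 u1 u2 v1 v2 : C) :
  0 <= alpha -> 0 < B1 ->
  (1 + alpha) * a2 = B1 * u1 ->
  2 * (1 + 2 * alpha) * a3 - (1 + 3 * alpha) * a2 ^ 2 = B1 * u2 + B2 * u1 ^ 2 ->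
  (1 + alpha) * - a2 = B1 * v1 ->
  2 * (1 + 2 * alpha) * (2 * a2 ^ 2 - a3) - (1 + 3 * alpha) * (- a2) ^ 2
    = B1 * v2 + B2 * v1 ^ 2 ->
  Cmod u1 <= 1 -> Cmod (u2 + u1 ^ 2) <= 1 -> Cmod (v2 + v1 ^ 2) <= 1 ->
  (1 + alpha) * Cmod (B1 ^ 2 + (1 + alpha) * (B1 - B2)) * Cmod a2 ^ 2 <= B1 ^ 3 /\
  Cmod a3 <= (B1 + Cmod (B2 - B1)) / (1 + alpha).
Proof.
  intros Ha HB E1 E2 E3 E4 Hu1 Hs Ht.
  assert (CB : RtoC B1 <> 0) by (intros E; injection E; lra).
  assert (Ev : v1 = - u1).
  { apply Cminus_eq_0. replace (v1 - - u1) with ((B1 * v1 + B1 * u1) / B1) by (field; exact CB).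
    rewrite <- E1, <- E3. field. exact CB. }
  subst v1. replace (v2 + (- u1) ^ 2) with (v2 + u1 ^ 2) in Ht by ring.
  set (s := u2 + u1 ^ 2) in *. set (t := v2 + u1 ^ 2) in *.
  assert (E2' : 2 * (1 + 2 * alpha) * a3 - (1 + 3 * alpha) * a2 ^ 2
    = B1 * s + (B2 - B1) * u1 ^ 2) by (rewrite E2; unfold s; ring).
  assert (E4' : (3 + 5 * alpha) * a2 ^ 2 - 2 * (1 + 2 * alpha) * a3
    = B1 * t + (B2 - B1) * u1 ^ 2).
  { transitivity (B1 * v2 + B2 * (- u1) ^ 2); [rewrite <- E4|unfold t]; ring. }
  split.
  - (* Multiply the sum of the two relations by B1 ^ 2 and substitute
       B1 u1 = (1 + alpha) a2. *)
    assert (K : 2 * (RtoC (1 + alpha) * (B1 ^ 2 + (1 + alpha) * (B1 - B2)) * a2 ^ 2)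
      = B1 ^ 3 * (s + t)).
    { rewrite RtoC_plus. transitivity (B1 ^ 2 * (2 * (1 + alpha) * a2 ^ 2)
        + 2 * (B1 - B2) * ((1 + alpha) * a2) ^ 2); [ring|].
      replace (2 * (1 + alpha) * a2 ^ 2) with (B1 * s + (B2 - B1) * u1 ^ 2
        + (B1 * t + (B2 - B1) * u1 ^ 2)) by (rewrite <- E2', <- E4'; ring).
      rewrite E1. ring. }
    apply (f_equal Cmod) in K. rewrite !Cmod_mult, !Cmod_pow in K.
    rewrite !Cmod_real in K by lra.
    assert (Hst : Cmod (s + t) <= 2) by (generalize (Cmod_triangle s t); lra).
    assert (B1 ^ 3 * Cmod (s + t) <= B1 ^ 3 * 2).
    { apply Rmult_le_compat_l; [apply pow_le; lra|exact Hst]. }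
    lra.
  - assert (K : 4 * (1 + alpha) * (1 + 2 * alpha) * a3
      = (3 + 5 * alpha) * (B1 * s + (B2 - B1) * u1 ^ 2)
        + (1 + 3 * alpha) * (B1 * t + (B2 - B1) * u1 ^ 2)).
    { rewrite <- E2', <- E4'. ring. }
    set (L := (B1 + Cmod (B2 - B1))%R).
    assert (HL : forall x, Cmod x <= 1 -> Cmod (B1 * x + (B2 - B1) * u1 ^ 2) <= L).
    { intros x Hx. apply Rle_trans with (1 := Cmod_triangle _ _).
      rewrite !Cmod_mult, Cmod_pow, Cmod_real by lra. unfold L.
      generalize (Cmod_ge_0 u1) (Cmod_ge_0 (B2 - B1)) (Cmod_ge_0 x). intros.
      assert (Cmod u1 ^ 2 <= 1) by nra.
      apply Rplus_le_compat; [nra|].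
      rewrite <- (Rmult_1_r (Cmod (B2 - B1))) at 2. now apply Rmult_le_compat_l. }
    assert (H1 := HL s Hs). assert (H2 := HL t Ht).
    apply (f_equal Cmod) in K.
    replace (4 * (1 + alpha) * (1 + 2 * alpha)) with (RtoC (4 * (1 + alpha) * (1 + 2 * alpha))) in K
      by now rewrite !RtoC_mult, !RtoC_plus, RtoC_mult.
    rewrite Cmod_mult, Cmod_real in K by (apply Rmult_le_pos; lra).
    assert (K2 : 4 * (1 + alpha) * (1 + 2 * alpha) * Cmod a3
      <= (3 + 5 * alpha) * L + (1 + 3 * alpha) * L).
    { rewrite K. apply Rle_trans with (1 := Cmod_triangle _ _).
      replace (3 + 5 * alpha) with (RtoC (3 + 5 * alpha))
        by now rewrite !RtoC_plus, RtoC_mult.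
      replace (1 + 3 * alpha) with (RtoC (1 + 3 * alpha))
        by now rewrite !RtoC_plus, RtoC_mult.
      rewrite !(Cmod_mult (RtoC _)), (Cmod_real (3 + 5 * alpha)), (Cmod_real (1 + 3 * alpha)) by lra.
      apply Rplus_le_compat; apply Rmult_le_compat_l; lra. }
    apply Rmult_le_reg_l with (4 * (1 + 2 * alpha) * (1 + alpha))%R.
    + repeat apply Rmult_lt_0_compat; lra.
    + replace (4 * (1 + 2 * alpha) * (1 + alpha) * (L / (1 + alpha)))%R
        with ((3 + 5 * alpha) * L + (1 + 3 * alpha) * L)%R by (field; lra).
      lra.
Qed.

Lemma unit_disc_0 : unit_disc 0.
Proof. unfold unit_disc. rewrite Cmod_0. lra. Qed.

Lemma subordinate_mocanu_coefficients (alpha : R) (phi f : C -> C) (B a : nat -> C) :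
  expands phi B -> B 0%nat = 1 ->
  expands f a -> a 0%nat = 0 -> a 1%nat = 1 ->
  subordinate (mocanu alpha f) phi ->
  exists u1 u2 : C,
    (1 + alpha) * a 2%nat = B 1%nat * u1 /\
    2 * (1 + 2 * alpha) * a 3%nat - (1 + 3 * alpha) * a 2%nat ^ 2
      = B 1%nat * u2 + B 2%nat * u1 ^ 2 /\
    Cmod u1 <= 1 /\ Cmod (u2 + u1 ^ 2) <= 1.
Proof.
  intros Hphi HB0 Hf Ha0 Ha1 (_ & _ & w & Hw & HD & Hw0 & Heq).
  destruct (Hw 0 unit_disc_0) as [u Hu]. apply has_power_series_at_0 in Hu.
  exists (u 1%nat), (u 2%nat).
  destruct (schwarz_coefficients _ _ Hw HD Hw0 Hu) as [H1 H2].
  assert (Hu0 : u 0%nat = 0) by now rewrite <- (expands_at_0 _ _ Hu).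
  destruct (mocanu_coefficients alpha phi f w B a u) as [E1 E2]; auto.
  exists 1%R. split; [lra|exact Heq].
Qed.

(* [Re (B 1)] is [B 1] itself, since [B 1] is the positive real [phi' 0]. *)
Theorem theorem2p3 :
  forall (alpha : R) (phi : C -> C) (B : nat -> C) (f : C -> C) (a : nat -> C),
    (0 <= alpha)%R ->
    ma_minda phi ->
    has_power_series phi 0%C B ->
    M_sigma alpha phi f ->
    has_power_series f 0%C a ->
    let B1 : R := Re (B 1%nat) in
    let B2 : C := B 2%nat in
    let den : R :=
      sqrt ((1 + alpha) * Cmod (B1 ^ 2 + (1 + alpha) * (B1 - B2))%C)%R in
    (den <> 0%R -> (Cmod (a 2%nat) <= B1 * sqrt B1 / den)%R) /\
    (Cmod (a 3%nat) <= (B1 + Cmod (B2 - B1)%C) / (1 + alpha))%R.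
Proof.
  intros alpha phi B f a Halpha (_ & _ & Hphi0 & (d & d0 & Hd) & _) HB
    (((_ & Hf0 & Hf1) & (_ & Hinj) & _) & g & ((Hg & _) & r & r0 & Hfg) & Sf & Sg) Ha.
  apply has_power_series_at_0 in HB, Ha.
  assert (EB0 : B 0%nat = 1) by now rewrite <- (expands_at_0 _ _ HB).
  assert (Ea0 : a 0%nat = 0) by now rewrite <- (expands_at_0 _ _ Ha).
  assert (Ea1 : a 1%nat = 1).
  { rewrite <- Hf1, (expands_at_0 _ _ (expands_derive _ _ Ha)). simpl. ring. }
  assert (EB1 : B 1%nat = RtoC d).
  { rewrite <- Hd, (expands_at_0 _ _ (expands_derive _ _ HB)). simpl. ring. }
  destruct (Hg 0 unit_disc_0) as [b Hb]. apply has_power_series_at_0 in Hb.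
  (* Near the origin g takes values in the disc with f (g 0) = 0 = f 0, so g 0 = 0
     because f is injective. *)
  assert (Eb0 : b 0%nat = 0).
  { rewrite <- (expands_at_0 _ _ Hb).
    destruct (Hfg 0) as [Hg0 Hfg0]; [now rewrite Cmod_0|].
    apply Hinj; [exact Hg0|exact unit_disc_0|]. now rewrite Hfg0, Hf0. }
  destruct (inverse_coefficients f g a b) as (Eb1 & Eb2 & Eb3); auto.
  { exists r. split; [exact r0|]. intros w Hw. now apply Hfg. }
  destruct (subordinate_mocanu_coefficients alpha phi f B a) as (u1 & u2 & U1 & U2 & U3 & U4);
    auto.
  destruct (subordinate_mocanu_coefficients alpha phi g B b) as (v1 & v2 & V1 & V2 & _ & V4);
    auto.
  rewrite Eb2 in V1, V2. rewrite Eb3 in V2. rewrite EB1 in U1, U2, V1, V2.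
  intros B1 B2 den.
  assert (EB1' : B1 = d) by (unfold B1; now rewrite EB1).
  clearbody B1. subst B1.
  destruct (coefficient_estimates alpha d B2 (a 2%nat) (a 3%nat) u1 u2 v1 v2) as [R2 R3]; auto.
  split; [|exact R3]. intros Hden.
  set (D := ((1 + alpha) * Cmod (d ^ 2 + (1 + alpha) * (d - B2))%C)%R) in *.
  assert (D0 : (0 < D)%R).
  { apply Rnot_le_lt. intros HD. apply Hden. now apply sqrt_neg_0. }
  assert (Hs : (0 < den)%R) by now apply sqrt_lt_R0.
  assert (Hden2 : (den * den = D)%R) by (apply sqrt_sqrt; lra).
  assert (Hd2 : (sqrt d * sqrt d = d)%R) by (apply sqrt_sqrt; lra).
  apply Rsqr_incr_0_var.
  - rewrite Rsqr_div', !Rsqr_mult. unfold Rsqr. rewrite Hden2, Hd2.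
    apply Rmult_le_reg_r with D; [exact D0|].
    unfold Rdiv. rewrite (Rmult_assoc _ (/ D)), Rinv_l, Rmult_1_r by lra.
    simpl in R2. lra.
  - apply Rmult_le_pos; [apply Rmult_le_pos; [lra|apply sqrt_pos]|].
    now apply Rlt_le, Rinv_0_lt_compat.
Qed.
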